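(* Let $B$ be a $p$-band in a $p$-Fatou space $(X,p,E)$. Then $B$ is a band in the vector lattice $X$.
   Context: All vector lattices are real and Archimedean. A lattice-normed vector lattice (LNVL) is a triple $(X,p,E)$, where $X$ and $E$ are vector lattices and $p:X\to E_+$ satisfies: $p(x)=0\Leftrightarrow x=0$; $p(\lambda x)=|\lambda|p(x)$ for $\lambda\in\mathbb{R}$; $p(x+y)\le p(x)+p(y)$; and $|x|\le|y|\Rightarrow p(x)\le p(y)$. An LNVL $(X,p,E)$ is a $p$-Fatou space if $0\le x_\alpha\uparrow x$ in $X$ implies $p(x_\alpha)\uparrow p(x)$ in $E$ (where $x_\alpha\uparrow x$ means that the net is increasing with supremum $x$). A subset $B\subseteq X$ is a $p$-band if there is a nonempty $M\subseteq X$ such that $B=\{x\in X: p(x)\wedge p(m)=0 \text{ for all } m\in M\}$. A band in $X$ is a band in the usual sense of vector lattices (an order closed ideal). *)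

(* Defs.v *)
From HB Require Import structures.
From mathcomp Require Import all_boot all_order all_algebra.
From mathcomp Require Import boolp classical_sets reals.

Set Implicit Arguments.
Unset Strict Implicit.
Unset Printing Implicit Defensive.

Import Order.TTheory GRing.Theory Num.Theory.

Local Open Scope classical_set_scope.
Local Open Scope ring_scope.

(* The lattice operations are fields of this mixin, and the library's lattice
   structure is derived from them below: a structure joining [Order.Lattice] and
   [GRing.Lmodule] directly would need a join with [Num.RealDomain], which
   Hierarchy-Builder does not allow to be added after the fact. *)
HB.mixin Record isArchimedeanVectorLattice (R : realType) V
    of Num.POrderedZmodule V & GRing.Lmodule R V := {
  vmeet : V -> V -> V;
  vjoin : V -> V -> V;
  vlat_lexI : forall x y z : V, (x <= vmeet y z) = (x <= y) && (x <= z);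
  vlat_leUx : forall x y z : V, (vjoin x y <= z) = (x <= z) && (y <= z);
  vlat_lerD2r : forall x y z : V, x <= y -> x + z <= y + z;
  vlat_scaler_ge0 : forall (a : R) (x : V), 0 <= a -> 0 <= x -> 0 <= a *: x;
  vlat_archimedean : forall x y : V,
    0 <= x -> (forall n : nat, x *+ n <= y) -> x = 0
}.

#[short(type="vectorLatticeType")]
HB.structure Definition VectorLattice (R : realType) :=
  { V of Num.POrderedZmodule V & GRing.Lmodule R V
       & isArchimedeanVectorLattice R V }.

HB.instance Definition _ (R : realType) (V : vectorLatticeType R) :=
  @Order.POrder_MeetJoin_isLattice.Build ring_display V
    vmeet vjoin vlat_lexI vlat_leUx.

Definition vabs (R : realType) (V : vectorLatticeType R) (x : V) : V :=
  (x `|` (- x))%O.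

(* The relation is a preorder: antisymmetry is not required of the index set of
   a net. *)
Record directed (I : Type) (le : I -> I -> Prop) : Prop := Directed {
  directed_inhabited : exists i : I, True;
  directed_refl : forall i, le i i;
  directed_trans : forall i j k, le i j -> le j k -> le i k;
  directed_ub : forall i j, exists2 k, le i k & le j k
}.

Section VectorLatticeDefs.
Context {R : realType} {V : vectorLatticeType R}.

Definition net_increases_to (I : Type) (le : I -> I -> Prop)
    (u : I -> V) (x : V) : Prop :=
  (forall i j, le i j -> u i <= u j) /\ supremums (range u) x.

Definition net_decreases_to (I : Type) (le : I -> I -> Prop)
    (u : I -> V) (x : V) : Prop :=
  (forall i j, le i j -> u j <= u i) /\ infimums (range u) x.

(* The dominating net [y] may have an index set of its own. *)
Definition order_converges (I : Type) (le : I -> I -> Prop)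
    (u : I -> V) (x : V) : Prop :=
  exists (J : Type) (leJ : J -> J -> Prop) (y : J -> V),
    [/\ directed leJ, net_decreases_to leJ y 0
      & forall j, exists i0, forall i, le i0 i -> vabs (u i - x) <= y j].

Definition order_closed (B : set V) : Prop :=
  forall (I : Type) (le : I -> I -> Prop) (u : I -> V) (x : V),
    directed le -> (forall i, B (u i)) -> order_converges le u x -> B x.

Record ideal (B : set V) : Prop := Ideal {
  ideal0 : B 0;
  idealD : forall x y, B x -> B y -> B (x + y);
  idealZ : forall (a : R) x, B x -> B (a *: x);
  ideal_solid : forall x y, B y -> vabs x <= vabs y -> B x
}.

Definition band (B : set V) : Prop := ideal B /\ order_closed B.

End VectorLatticeDefs.

Section LatticeNorm.
Context {R : realType} {X E : vectorLatticeType R}.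

Record lattice_normed (p : X -> E) : Prop := LatticeNormed {
  lnorm_ge0 : forall x, 0 <= p x;
  lnorm_eq0 : forall x, p x = 0 <-> x = 0;
  lnormZ : forall (a : R) x, p (a *: x) = `|a| *: p x;
  lnormD : forall x y, p (x + y) <= p x + p y;
  lnorm_mono : forall x y, vabs x <= vabs y -> p x <= p y
}.

Definition p_Fatou (p : X -> E) : Prop :=
  lattice_normed p /\
  forall (I : Type) (le : I -> I -> Prop) (u : I -> X) (x : X),
    directed le -> (forall i, 0 <= u i) -> net_increases_to le u x ->
    net_increases_to le (p \o u) (p x).

Definition p_band (p : X -> E) (B : set X) : Prop :=
  exists2 M : set X, M !=set0 &
    B = [set x | forall m, M m -> (p x `&` p m)%O = 0].

End LatticeNorm.

(* Main.v *)
Require Import Defs.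
From HB Require Import structures.
From mathcomp Require Import all_boot all_order all_algebra.
From mathcomp Require Import boolp classical_sets reals.

(** If [|u_i - x| <= y_j] eventually, with [u_i] in [B] and [y] decreasing to
    [0], then [v_j = (|x| - y_j)^+] lies in [B] by solidity, since
    [v_j <= |u_i|], and [v] increases to [|x|]. The Fatou property gives
    [p |x| = sup p v_j]. For [w = p |x| /\ p m], disjointness of [p v_j] and [w]
    gives [p v_j + w <= p |x|] for all [j]; taking suprema, [w <= 0]. *)

Set Implicit Arguments.
Unset Strict Implicit.
Unset Printing Implicit Defensive.

Import Order.TTheory GRing.Theory Num.Theory.

Local Open Scope classical_set_scope.
Local Open Scope ring_scope.

Section VectorLatticeTheory.
Context {R : realType} {V : vectorLatticeType R}.
Implicit Types (x y z a b c : V) (k l : R).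

Lemma vlerD2r z x y : (x + z <= y + z) = (x <= y).
Proof.
apply/idP/idP; last exact: vlat_lerD2r.
by move=> /(vlat_lerD2r _ _ (- z)); rewrite !addrK.
Qed.

Lemma vlerD2l z x y : (z + x <= z + y) = (x <= y).
Proof. by rewrite ![z + _]addrC vlerD2r. Qed.

Lemma vlerBlDr x y z : (x - y <= z) = (x <= z + y).
Proof. by rewrite -(vlerD2r y (x - y)) subrK. Qed.

Lemma vlerBlDl x y z : (x - y <= z) = (x <= y + z).
Proof. by rewrite vlerBlDr addrC. Qed.

Lemma vlerD x y a b : x <= y -> a <= b -> x + a <= y + b.
Proof. by move=> xy ab; apply: (@le_trans _ _ (y + a)); rewrite ?vlerD2r ?vlerD2l. Qed.

Lemma vlerDl x y : (x <= x + y) = (0 <= y).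
Proof. by rewrite -{1}[x]addr0 vlerD2l. Qed.

Lemma vlerN2 x y : (- x <= - y) = (y <= x).
Proof. by rewrite -(vlerD2r (x + y) (- x)) addKr addrCA addNr addr0. Qed.

Lemma vler_wscale2r k l x : 0 <= x -> k <= l -> k *: x <= l *: x.
Proof.
move=> x0 kl; rewrite -[l](subrK k) scalerDl addrC vlerDl.
by rewrite vlat_scaler_ge0 // subr_ge0.
Qed.

Lemma vabs_ler x y : (vabs x <= y) = (x <= y) && (- x <= y).
Proof. exact: leUx. Qed.

Lemma vler_abs x : x <= vabs x.
Proof. exact: leUl. Qed.

(** Adding [x <= vabs x] and [- x <= vabs x] gives [0 <= vabs x + vabs x], which is then halved. *)
Lemma vabs_ge0 x : 0 <= vabs x.
Proof.
have : vabs x + vabs x >= 0.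
  by rewrite -(subrr x) vlerD ?leUl ?leUr.
rewrite -mulr2n -scaler_nat => /(vlat_scaler_ge0 (2^-1 : R)).
by rewrite scalerA mulVf ?pnatr_eq0// scale1r; apply; rewrite invr_ge0.
Qed.

Lemma vabs_id x : 0 <= x -> vabs x = x.
Proof.
move=> x0; apply/le_anti; rewrite vler_abs andbT vabs_ler lexx /=.
by rewrite (le_trans _ x0) // -oppr0 vlerN2.
Qed.

Lemma vabsN x : vabs (- x) = vabs x.
Proof. by rewrite /vabs opprK joinC. Qed.

Lemma vabs_triangle x y : vabs (x + y) <= vabs x + vabs y.
Proof. by rewrite vabs_ler opprD !vlerD ?leUl ?leUr. Qed.

(** The element [a + b - c] lies below [a] because [b <= c], and below [b] because [a <= c]; hence
    it lies below their meet. *)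
Lemma disjoint_add_le a b c :
  (a `&` b)%O = 0 -> a <= c -> b <= c -> a + b <= c.
Proof.
move=> ab0 ac bc; rewrite -[c]addr0 -vlerBlDl -ab0 lexI.
by rewrite !vlerBlDl vlerD2r ac addrC vlerD2r bc.
Qed.

Lemma disjointD a b c : 0 <= a -> 0 <= b -> 0 <= c ->
  (a `&` c)%O = 0 -> (b `&` c)%O = 0 -> ((a + b) `&` c)%O = 0.
Proof.
move=> a0 b0 c0 ac0 bc0; have ab0 : 0 <= a + b by rewrite -[0]addr0 vlerD.
apply/le_anti; rewrite lexI c0 ab0 !andbT.
set z := (_ `&` _)%O.
have zab : z <= a + b by exact: leIl.
have zc : z <= c by exact: leIr.
(* It is enough that [z <= b], and this holds because [z - b] is below both [a] and [c], which are
   disjoint. *)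
rewrite -bc0 lexI zc andbT -[b]addr0 -vlerBlDl -ac0 lexI.
by rewrite vlerBlDr zab vlerBlDr (le_trans zc) // vlerDl.
Qed.

Lemma disjoint_le a b c : 0 <= a -> 0 <= c -> a <= b ->
  (b `&` c)%O = 0 -> (a `&` c)%O = 0.
Proof.
move=> a0 c0 ab bc0; apply/le_anti; rewrite lexI a0 c0 -bc0 !andbT.
by apply: leI2.
Qed.

(** Natural multiples of [a] are repeated sums, covered by [disjointD]; a real multiple is dominated
    by the next natural one. *)
Lemma disjointZ k a c : 0 <= k -> 0 <= a -> 0 <= c ->
  (a `&` c)%O = 0 -> ((k *: a) `&` c)%O = 0.
Proof.
move=> k0 a0 c0 ac0.
have nat_disjoint n : ((n%:R *: a) `&` c)%O = 0.
  elim: n => [|n IHn]; first by rewrite scale0r; apply/meet_idPl.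
  by rewrite -natr1 scalerDl scale1r disjointD // vlat_scaler_ge0.
apply: disjoint_le (nat_disjoint (Num.truncn k).+1) => //.
  exact: vlat_scaler_ge0.
by apply: vler_wscale2r => //; apply/ltW/truncnS_gt.
Qed.

Lemma disjoint_sup (A : set V) s c : 0 <= s -> 0 <= c -> supremums A s ->
  (forall a, A a -> 0 <= a /\ (a `&` c)%O = 0) -> (s `&` c)%O = 0.
Proof.
move=> s0 c0 [ubs lubs] Ac; have w0 : 0 <= (s `&` c)%O by rewrite lexI s0.
apply/le_anti; rewrite w0 andbT.
rewrite -(vlerD2l s) addr0.
(* The right-hand side bounds [A] from above: each [a] in [A] is disjoint from the meet of [s] and
   [c], and both lie below [s], so their sum does too. *)
suff : s <= s - (s `&` c)%O.
  by rewrite -(vlerD2r (s `&` c)%O) subrK.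
apply: lubs => a Aa; have [a0 ac0] := Ac a Aa.
rewrite -(vlerD2r (s `&` c)%O) subrK; apply: disjoint_add_le.
- by rewrite meetC; apply: disjoint_le (leIr _ _) _; rewrite // meetC.
- exact: ubs.
- exact: leIl.
Qed.

Lemma supremums_pos_part_sub (I : Type) (le : I -> I -> Prop) (y : I -> V) x :
  0 <= x -> net_decreases_to le y 0 ->
  net_increases_to le (fun i => (x - y i) `|` 0)%O x.
Proof.
move=> x0 [ydec [lb0 glb0]]; split=> [i j ij|].
  by apply: leU2 => //; rewrite vlerD2l vlerN2 ydec.
split=> [_ [i _ <-]|z ubz].
  by rewrite leUx x0 andbT vlerBlDl addrC vlerDl lb0 //; exists i.
(* An upper bound [z] dominates every [x - y i], so [x - z] is a lower bound of [y], whose infimum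
   is [0]. *)
rewrite -[z]addr0 -vlerBlDl; apply: glb0 => _ [i _ <-].
rewrite vlerBlDr addrC -vlerBlDr.
by apply: le_trans (leUl _ _) (ubz _ _); exists i.
Qed.

End VectorLatticeTheory.

Section PBand.
Context {R : realType} {X E : vectorLatticeType R}.
Variables (p : X -> E) (M : set X).

Let B : set X := [set x | forall m, M m -> (p x `&` p m)%O = 0].

(** Each ideal axiom follows from the matching axiom of the norm and a stability property of
    disjointness in [E]. *)
Lemma p_band_ideal : lattice_normed p -> ideal B.
Proof.
case=> p0 peq0 pZ pD pmono; split=> [m Mm|x y Bx By m Mm|k x Bx m Mm|x y By xy m Mm].
- by rewrite (peq0 0).2 //; apply/meet_idPl.
- apply: disjoint_le (pD x y) _ => //.
  by apply: disjointD => //; [exact: Bx | exact: By].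
- by rewrite pZ; apply: disjointZ => //; exact: Bx.
- by apply: disjoint_le (pmono _ _ xy) _ => //; exact: By.
Qed.

Lemma p_band_order_closed : p_Fatou p -> order_closed B.
Proof.
move=> [hp pFatou] I le u x dir Bu [J [leJ [y [dirJ ydec yconv]]]] m Mm.
have solid := ideal_solid (p_band_ideal hp).
have Bv j : B ((vabs x - y j) `|` 0)%O.
  have [i0 /(_ i0 (directed_refl dir i0)) uxy] := yconv j.
  apply: solid (Bu i0) _.
  rewrite vabs_id ?leUr // leUx vabs_ge0 andbT vlerBlDr.
  (* Writing [x] as [u i0 - (u i0 - x)] bounds its modulus by that of [u i0] plus [y j]. *)
  rewrite -{1}[x](subKr (u i0)) (le_trans (vabs_triangle _ _)) //.
  by rewrite vabsN vlerD2l.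
have [_ sup_pv] := pFatou _ _ _ _ dirJ (fun j => leUr _ _)
  (supremums_pos_part_sub (vabs_ge0 x) ydec).
(* The Fatou property concerns positive nets, so it yields [p (vabs x)]; monotonicity of [p] carries
   disjointness back to [p x]. *)
apply: (@disjoint_le _ _ _ (p (vabs x))); try exact: lnorm_ge0.
  by apply: lnorm_mono => //; rewrite (vabs_id (vabs_ge0 x)).
apply: disjoint_sup sup_pv _; try exact: lnorm_ge0.
by move=> _ [j _ <-]; split; [exact: lnorm_ge0 | exact: Bv].
Qed.

End PBand.

Theorem proposition2p18 (R : realType) (X E : vectorLatticeType R)
    (p : X -> E) (hp : p_Fatou p) (B : set X) (hB : p_band p B) :
  band B.
Proof.
case: hB => M _ ->; split; first exact: p_band_ideal hp.1.
exact: p_band_order_closed.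
Qed.
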